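(* Let $\mathcal{F}$ be a $k$-linear autoequivalence of $\mathrm{rgr}\,A$. Then there are unique integers $a\in\{1,-1\}$ and $b\in\mathbb{Z}$ such that for all $n\in\mathbb{Z}$, $\{\mathcal{F}(X\langle n\rangle),\mathcal{F}(Y\langle n\rangle)\}\cong\{X\langle an+b\rangle,Y\langle an+b\rangle\}$ (as unordered pairs up to isomorphism), and for all $\lambda\in k\setminus\mathbb{Z}$, $\mathcal{F}(M_\lambda)\cong M_{a\lambda+b}$.
   Context: $k$ algebraically closed of characteristic $0$; $A=k\langle x,y\rangle/(xy-yx-1)$ graded by $\deg x=1,\deg y=-1$; $z=xy$. $\mathrm{rgr}\,A$: graded right $A$-modules with degree-preserving maps. $M\langle n\rangle_j=M_{j-n}$, $X=A/xA$, $Y=(A/yA)\langle1\rangle$, $M_\lambda=A/(z+\lambda)A$. *)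

(* Defs.v *)
From HB Require Import structures.
From mathcomp Require Import all_boot all_order all_algebra.
Set Implicit Arguments. Unset Strict Implicit. Unset Printing Implicit Defensive.
Import GRing.Theory.
Local Open Scope ring_scope.

(* Graded right modules over the Weyl algebra                                *)
(*   A = k<x,y>/(xy - yx - 1),  deg x = 1, deg y = -1.                       *)
(* Since A is presented by generators x, y and the relation xy - yx = 1, a   *)
(* graded right A-module is exactly a family of k-vector spaces (M_i)_{i:Z}  *)
(* with k-linear maps  (. x) : M_i -> M_{i+1}  and  (. y) : M_{i+1} -> M_i   *)
(* such that  (m.x).y - (m.y).x = m  for every homogeneous m.                *)

Record gmod (k : fieldType) := GMod {
  gcar : int -> lmodType k;
  gx : forall i : int, gcar i -> gcar (i + 1);
  gy : forall i : int, gcar (i + 1) -> gcar i;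
  gx_lin : forall i, linear (@gx i);
  gy_lin : forall i, linear (@gy i);
  g_rel : forall i (m : gcar (i + 1)), gy (gx m) - gx (gy m) = m
}.
Arguments gx {k} _ {i}.
Arguments gy {k} _ {i}.

Record ghom (k : fieldType) (M N : gmod k) := GHom {
  hf : forall i, gcar M i -> gcar N i;
  hf_lin : forall i, linear (@hf i);
  hf_x : forall i (m : gcar M i), hf (gx M m) = gx N (hf m);
  hf_y : forall i (m : gcar M (i + 1)), hf (gy M m) = gy N (hf m)
}.
Arguments hf {k M N} _ {i}.

Definition heq (k : fieldType) (M N : gmod k) (f g : ghom M N) : Prop :=
  forall i (m : gcar M i), hf f m = hf g m.

Section Basics.
Variable k : fieldType.

Lemma lin_add (U V : lmodType k) (f : U -> V) : linear f ->
  forall u v, f (u + v) = f u + f v.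
Proof. by move=> lf u v; rewrite -[u]scale1r lf !scale1r. Qed.

Lemma lin_scale (U V : lmodType k) (f : U -> V) : linear f ->
  forall a u, f (a *: u) = a *: f u.
Proof. by move=> lf; apply: scalable_linear lf. Qed.

Lemma lin_comp (U V W : lmodType k) (f : V -> W) (g : U -> V) :
  linear f -> linear g -> linear (fun u => f (g u)).
Proof. by move=> lf lg a u v; rewrite lg lf. Qed.

Lemma lin_id (U : lmodType k) : linear (fun u : U => u).
Proof. by []. Qed.

Definition hid (M : gmod k) : ghom M M :=
  @GHom k M M (fun i m => m) (fun i => @lin_id _) (fun _ _ => erefl) (fun _ _ => erefl).

Section HomOps.
Variables M N P : gmod k.

Lemma hcomp_lin (g : ghom N P) (f : ghom M N) i :
  linear (fun m : gcar M i => hf g (hf f m)).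
Proof. by apply: lin_comp; apply: hf_lin. Qed.
Lemma hcomp_x (g : ghom N P) (f : ghom M N) i (m : gcar M i) :
  hf g (hf f (gx M m)) = gx P (hf g (hf f m)).
Proof. by rewrite !hf_x. Qed.
Lemma hcomp_y (g : ghom N P) (f : ghom M N) i (m : gcar M (i + 1)) :
  hf g (hf f (gy M m)) = gy P (hf g (hf f m)).
Proof. by rewrite !hf_y. Qed.

Definition hcomp (g : ghom N P) (f : ghom M N) : ghom M P :=
  GHom (hcomp_lin g f) (hcomp_x g f) (hcomp_y g f).

Lemma hadd_lin (f g : ghom M N) i :
  linear (fun m : gcar M i => hf f m + hf g m).
Proof.
move=> a u v; rewrite !(hf_lin f) !(hf_lin g) scalerDr.
by rewrite -!addrA; congr (_ + _); rewrite addrCA.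
Qed.
Lemma hadd_x (f g : ghom M N) i (m : gcar M i) :
  hf f (gx M m) + hf g (gx M m) = gx N (hf f m + hf g m).
Proof. by rewrite (lin_add (@gx_lin _ N i)) !hf_x. Qed.
Lemma hadd_y (f g : ghom M N) i (m : gcar M (i + 1)) :
  hf f (gy M m) + hf g (gy M m) = gy N (hf f m + hf g m).
Proof. by rewrite (lin_add (@gy_lin _ N i)) !hf_y. Qed.

Definition hadd (f g : ghom M N) : ghom M N :=
  GHom (hadd_lin f g) (hadd_x f g) (hadd_y f g).

Lemma hscale_lin (c : k) (f : ghom M N) i :
  linear (fun m : gcar M i => c *: hf f m).
Proof. by move=> a u v; rewrite (hf_lin f) scalerDr !scalerA mulrC. Qed.
Lemma hscale_x (c : k) (f : ghom M N) i (m : gcar M i) :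
  c *: hf f (gx M m) = gx N (c *: hf f m).
Proof. by rewrite (lin_scale (@gx_lin _ N i)) hf_x. Qed.
Lemma hscale_y (c : k) (f : ghom M N) i (m : gcar M (i + 1)) :
  c *: hf f (gy M m) = gy N (c *: hf f m).
Proof. by rewrite (lin_scale (@gy_lin _ N i)) hf_y. Qed.

Definition hscale (c : k) (f : ghom M N) : ghom M N :=
  GHom (hscale_lin c f) (hscale_x c f) (hscale_y c f).

End HomOps.

Definition giso (M N : gmod k) : Prop :=
  exists (f : ghom M N) (g : ghom N M),
    heq (hcomp g f) (hid M) /\ heq (hcomp f g) (hid N).

Definition castg (M : gmod k) (i j : int) (e : i = j) (m : gcar M i) : gcar M j :=
  ecast t (gcar M t) e m.

Lemma castg_lin (M : gmod k) i j (e : i = j) : linear (@castg M i j e).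
Proof. by case: j / e. Qed.

Lemma castg_comp (M : gmod k) i j l (e1 : i = j) (e2 : j = l) (m : gcar M i) :
  castg e2 (castg e1 m) = castg (etrans e1 e2) m.
Proof. by case: l / e2; case: j / e1. Qed.

Lemma castg_refl (M : gmod k) i (e : i = i) (m : gcar M i) : castg e m = m.
Proof. by rewrite (eq_irrelevance e erefl). Qed.

Lemma castg_yx (M : gmod k) i j (e : i = j) (m : gcar M i) :
  gy M (gx M (castg e m)) = castg e (gy M (gx M m)).
Proof. by case: j / e. Qed.

Lemma shift_e (n j : int) : j - n + 1 = j + 1 - n.
Proof. by rewrite addrAC. Qed.

Section Shift.
Variables (n : int) (M : gmod k).

Definition shx (j : int) (m : gcar M (j - n)) : gcar M (j + 1 - n) :=
  castg (shift_e n j) (gx M m).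
Definition shy (j : int) (m : gcar M (j + 1 - n)) : gcar M (j - n) :=
  gy M (castg (esym (shift_e n j)) m).

Lemma shx_lin j : linear (@shx j).
Proof. by apply: lin_comp; [apply: castg_lin|apply: gx_lin]. Qed.
Lemma shy_lin j : linear (@shy j).
Proof. by apply: lin_comp; [apply: gy_lin|apply: castg_lin]. Qed.

Lemma sh_rel j (m : gcar M (j + 1 - n)) : shy (shx m) - shx (shy m) = m.
Proof.
rewrite /shx /shy castg_comp castg_refl.
set m0 := castg (esym (shift_e n j)) m.
have -> : gx M (gy M m0) = gy M (gx M m0) - m0.
  by apply: (addIr m0); rewrite subrK -{2}[m0](g_rel m0) addrCA subrr addr0.
rewrite (zmod_morphism_linear (castg_lin _)) /m0 castg_yx !castg_comp !castg_refl.
by rewrite opprB addrCA subrr addr0.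
Qed.

Definition shift : gmod k :=
  @GMod k (fun j => gcar M (j - n)) shx shy shx_lin shy_lin sh_rel.
End Shift.

(* Modules with at most one-dimensional graded pieces, given by an explicit  *)
(* homogeneous basis: support S, basis vector u_i in degree i (S i), with    *)
(* u_i . x = cx i u_{i+1},  u_{i+1} . y = cy i u_i.                          *)
(* The piece in degree i is 'rV[k]_(S i)  (k if S i, 0 otherwise).           *)

Definition J1 (a b : bool) : 'M[k]_(a, b) := const_mx 1.

Lemma J1J1 (a b : bool) (m : 'rV[k]_a) :
  m *m J1 a b *m J1 b a = (b : nat)%:R *: m.
Proof.
case: a m => m; last by apply/rowP => -[].
case: b.
  apply/rowP => j; rewrite !mxE big_ord1 !mxE big_ord1 !mxE.
  by rewrite (ord1 j) !mulr1 /= mulr1n mul1r.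
by apply/rowP => j; rewrite !mxE big_ord0 mul0r.
Qed.

Lemma scale_rel (b : bool) (m : 'rV[k]_b) (c : k) : (b -> c = 1) -> c *: m = m.
Proof. by case: b m => m; [move=> ->; rewrite ?scale1r | move=> _; apply/rowP => -[]]. Qed.

Section Line.
Variables (S : int -> bool) (cx cy : int -> k).
Hypothesis h : forall i, S (i + 1) ->
      cy (i + 1) * cx (i + 1) * (S (i + 1 + 1) : nat)%:R
      - cx i * cy i * (S i : nat)%:R = 1.

Definition lnx (i : int) (m : 'rV[k]_(S i)) : 'rV[k]_(S (i + 1)) :=
  cx i *: (m *m J1 (S i) (S (i + 1))).
Definition lny (i : int) (m : 'rV[k]_(S (i + 1))) : 'rV[k]_(S i) :=
  cy i *: (m *m J1 (S (i + 1)) (S i)).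

Lemma lnx_lin i : linear (@lnx i).
Proof. by move=> a u v; rewrite /lnx mulmxDl -scalemxAl scalerDr !scalerA mulrC. Qed.
Lemma lny_lin i : linear (@lny i).
Proof. by move=> a u v; rewrite /lny mulmxDl -scalemxAl scalerDr !scalerA mulrC. Qed.

Lemma ln_rel i (m : 'rV[k]_(S (i + 1))) : lny (lnx m) - lnx (lny m) = m.
Proof.
rewrite /lnx /lny -!scalemxAl !J1J1 !scalerA -scalerBl.
by apply: (@scale_rel (S (i + 1))) => /h; rewrite -!mulrA.
Qed.

Definition linemod : gmod k :=
  @GMod k (fun i => 'rV[k]_(S i)) lnx lny lnx_lin lny_lin ln_rel.
End Line.

End Basics.

Import Order.TTheory Num.Theory.

Section Specific.
Variable k : fieldType.

(* X = A/xA : basis v_j = e y^(-j) in degree j <= 0;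
   v_j . x = j v_{j+1},  v_{j+1} . y = v_j. *)
Lemma X_h (i : int) : (i + 1 <= 0) ->
  1 * (i + 1)%:~R * (nat_of_bool (i + 1 + 1 <= 0))%:R
  - i%:~R * 1 * (nat_of_bool (i <= 0))%:R = 1 :> k.
Proof.
move=> hi; have Si : i <= 0 by rewrite ltW // -lezD1.
rewrite Si; case: (boolP (i + 1 + 1 <= 0)) => h2.
  by rewrite !mulr1n !mulr1 mul1r intrD addrAC subrr add0r.
have e : i + 1 = 0 by apply/le_anti; rewrite hi leNgt -lezD1 h2.
have ei : i = -1 by rewrite -[i](addrK 1) e add0r.
by rewrite mulr0n mulr1n !mulr1 mulr0 sub0r ei; simpl; rewrite opprK.
Qed.

Definition Xmod : gmod k :=
  @linemod k (fun i => i <= 0) (fun i => i%:~R) (fun _ => 1) X_h.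

(* A/yA : basis w_j = e x^j in degree j >= 0;
   w_j . x = w_{j+1},  w_{j+1} . y = (j+1) w_j. *)
Lemma Y0_h (i : int) : (0 <= i + 1) ->
  (i + 1 + 1)%:~R * 1 * (nat_of_bool (0 <= i + 1 + 1))%:R
  - 1 * (i + 1)%:~R * (nat_of_bool (0 <= i))%:R = 1 :> k.
Proof.
move=> hi; have -> : 0 <= i + 1 + 1 by rewrite (le_trans hi) // lerDl.
case: (boolP (0 <= i)) => h2.
  by rewrite !mulr1n !mulr1 mul1r intrD addrAC subrr add0r.
have e : i + 1 = 0 by apply/le_anti; rewrite hi andbT lezD1 ltNge h2.
by rewrite e mulr0n mulr0 subr0 mulr1n mulr1 add0r mulr1.
Qed.

Definition Y0mod : gmod k :=
  @linemod k (fun i => 0 <= i) (fun _ => 1) (fun i => (i + 1)%:~R) Y0_h.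

(* M_lambda = A/(z + lambda)A : basis u_j = e x^j (j >= 0), u_j = e y^(-j)
   (j < 0);  u_j . x = u_{j+1} (j >= 0), (j - lambda) u_{j+1} (j < 0);
   u_{j+1} . y = (j - lambda) u_j (j >= 0), u_j (j < 0). *)
Definition Mcx (l : k) (i : int) : k := if 0 <= i then 1 else i%:~R - l.
Definition Mcy (l : k) (i : int) : k := if 0 <= i then i%:~R - l else 1.

Lemma Mcxy (l : k) i : Mcx l i * Mcy l i = i%:~R - l.
Proof. by rewrite /Mcx /Mcy; case: ifP => _; rewrite ?mul1r ?mulr1. Qed.

Lemma M_h (l : k) (i : int) : true ->
  Mcy l (i + 1) * Mcx l (i + 1) * (nat_of_bool true)%:R
  - Mcx l i * Mcy l i * (nat_of_bool true)%:R = 1.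
Proof.
move=> _; rewrite !mulr1n !mulr1 mulrC !Mcxy intrD.
have -> : (1%:~R : k) = 1 by [].
by apply/eqP; rewrite subr_eq addrA [1 + _]addrC.
Qed.

Definition Mlam (l : k) : gmod k :=
  @linemod k (fun _ => true) (Mcx l) (Mcy l) (@M_h l).

End Specific.

Definition Xsh (k : fieldType) (n : int) : gmod k := shift n (Xmod k).
Definition Ysh (k : fieldType) (n : int) : gmod k := shift n (shift 1 (Y0mod k)).

Record gfunctor (k : fieldType) := GFunctor {
  Fo : gmod k -> gmod k;
  Fh : forall M N : gmod k, ghom M N -> ghom (Fo M) (Fo N);
  F_id : forall M, heq (Fh (hid M)) (hid (Fo M));
  F_comp : forall (M N P : gmod k) (g : ghom N P) (f : ghom M N),
      heq (Fh (hcomp g f)) (hcomp (Fh g) (Fh f))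
}.
Arguments Fh {k} _ {M N}.

Definition klinear_functor (k : fieldType) (F : gfunctor k) : Prop :=
  (forall (M N : gmod k) (f g : ghom M N), heq (Fh F (hadd f g)) (hadd (Fh F f) (Fh F g)))
  /\ (forall (M N : gmod k) (c : k) (f : ghom M N), heq (Fh F (hscale c f)) (hscale c (Fh F f))).

Definition autoequivalence (k : fieldType) (F : gfunctor k) : Prop :=
  (forall (M N : gmod k) (g : ghom (Fo F M) (Fo F N)), exists f : ghom M N, heq (Fh F f) g)
  /\ (forall (M N : gmod k) (f g : ghom M N), heq (Fh F f) (Fh F g) -> heq f g)
  /\ (forall N : gmod k, exists M : gmod k, giso (Fo F M) N).

(* Main.v *)
Require Import Defs.
From HB Require Import structures.
From mathcomp Require Import all_boot all_order all_algebra.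
From mathcomp Require Import zify ring.
From Stdlib Require Import Classical FunctionalExtensionality ProofIrrelevance.
Import Order.TTheory GRing.Theory Num.Theory.
Local Open Scope ring_scope.
Set Implicit Arguments. Unset Strict Implicit. Unset Printing Implicit Defensive.

(* On a homogeneous m of degree i put omega(m) = i m - m xy.  This is a natural
   endomorphism of the identity functor of rgr A, acting by l on M_l and by n on
   X<n> and Y<n>.  A nonzero module on which omega is a scalar l receives a nonzero
   (automatically injective) map from one of these simples with the same l.  Since F is
   an equivalence, the endomorphism F^-1(omega_{F M}) of M is natural in M; restricted to
   A[x^-1], whose endomorphism ring is k[omega], it is a polynomial p(omega).  Hence F sends simples
   over l to simples over p(l).  The inverse equivalence yields a polynomial q with
   p(q(l)) = l, so p is affine.  There are two simples over l when l is an integer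
   and only one otherwise, so p and q preserve the integers, and p(l) = a l + b with
   a = 1 or -1 and b an integer. *)

(** * Induction and dependent recursion over the integers *)

Lemma int_walk (P : int -> Prop) (i0 : int) :
  P i0 -> (forall i, i0 <= i -> P i -> P (i + 1)) ->
  (forall i, i < i0 -> P (i + 1) -> P i) -> forall i, P i.
Proof.
move=> h0 hup hdn i.
have up (n : nat) : P (i0 + n%:Z).
  elim: n => [|n IH]; first by rewrite addr0.
  have -> : i0 + n.+1%:Z = i0 + n%:Z + 1 by lia.
  by apply: hup IH; lia.
have dn (n : nat) : P (i0 - n%:Z).
  elim: n => [|n IH]; first by rewrite subr0.
  by apply: hdn; [lia | have -> : i0 - n.+1%:Z + 1 = i0 - n%:Z by lia].
case: (lerP i0 i) => h.
  by have -> : i = i0 + `|i - i0|%N%:Z by lia.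
by have -> : i = i0 - `|i - i0|%N%:Z by lia.
Qed.

Lemma fam_ecast (D : int -> Type) (w : forall i, D i) i j (e : i = j) :
  ecast t (D t) e (w i) = w j.
Proof. by case: j / e. Qed.

Lemma ecastK (D : int -> Type) i j (e : i = j) (e' : j = i) (x : D i) :
  ecast t (D t) e' (ecast t (D t) e x) = x.
Proof. by case: j / e e' => e'; rewrite (eq_irrelevance e' erefl). Qed.

Lemma PoszS n : Posz n + 1 = Posz n.+1. Proof. lia. Qed.
Lemma Negz0S : 0 = Negz 0 + 1. Proof. lia. Qed.
Lemma NegzSS n : Negz n = Negz n.+1 + 1. Proof. lia. Qed.

(** Starting at 0 lets the recursion follow the constructors of [int]. Their successors agree with
    [i + 1] only up to a proof, hence the transports. [int_family] translates to any starting
    degree. *)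
Lemma int_family0 (D : int -> Type) (T : forall i, D i -> D (i + 1))
    (T' : forall i, D (i + 1) -> D i) (v : D 0) :
  exists w : forall i, D i, [/\ w 0 = v,
    forall i, 0 <= i -> w (i + 1) = T i (w i) &
    forall i, i < 0 -> w i = T' i (w (i + 1))].
Proof.
pose up := fix up (n : nat) : D (Posz n) := match n with
  | 0%N => v | S n => ecast t (D t) (PoszS n) (T _ (up n)) end.
pose dn := fix dn (n : nat) : D (Negz n) := match n with
  | 0%N => T' _ (ecast t (D t) Negz0S v)
  | S n => T' _ (ecast t (D t) (NegzSS n) (dn n)) end.
pose w (i : int) : D i := match i with Posz n => up n | Negz n => dn n end.
exists w; split=> // -[n|n] // _.
  by rewrite -(fam_ecast w (esym (PoszS n))) /= ecastK.
case: n => [|n]; first by rewrite -(fam_ecast w Negz0S).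
by rewrite -(fam_ecast w (NegzSS n)).
Qed.

Lemma int_family (D : int -> Type) (T : forall i, D i -> D (i + 1))
    (T' : forall i, D (i + 1) -> D i) (i0 : int) (v : D i0) :
  exists w : forall i, D i, [/\ w i0 = v,
    forall i, i0 <= i -> w (i + 1) = T i (w i) &
    forall i, i < i0 -> w i = T' i (w (i + 1))].
Proof.
have e0 : i0 = 0 + i0 by lia.
have e1 j : j + i0 + 1 = j + 1 + i0 by lia.
have [w [w0 wu wd]] := @int_family0 (fun j => D (j + i0))
  (fun j x => ecast t (D t) (e1 j) (T _ x))
  (fun j x => T' _ (ecast t (D t) (esym (e1 j)) x)) (ecast t (D t) e0 v).
have e2 i : i - i0 + i0 = i by lia.
have e3 i : i = i - i0 + i0 by lia.
pose w' i := ecast t (D t) (e2 i) (w (i - i0)).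
have w'E j : w' (j + i0) = w j.
  rewrite /w'; have ej : j = j + i0 - i0 by lia.
  rewrite -(fam_ecast w ej); move: (e2 _); case: _ / ej => e.
  by rewrite (eq_irrelevance e erefl).
have w'1 j : w' (j + i0 + 1) = ecast t (D t) (esym (e1 j)) (w (j + 1)).
  by rewrite -w'E (fam_ecast w').
exists w'; split.
- by rewrite -[RHS](ecastK e0 (esym e0)) -w0 -w'E fam_ecast.
- move=> i hi; rewrite (e3 i) w'1 w'E wu; last by lia.
  by rewrite ecastK.
- move=> i hi; rewrite (e3 i) w'1 w'E wd //; lia.
Qed.

(** * Graded maps and the natural endomorphism [omega] *)

Section Category.
Variable k : fieldType.

(** Functional extensionality identifies the underlying families and proof irrelevance the remaining
    fields, so equal maps can be rewritten inside larger expressions. *)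
Lemma heq_eq (M N : gmod k) (f g : ghom M N) : heq f g -> f = g.
Proof.
case: f g => [f fl fx fy] [g gl ghx ghy] H.
have e : f = g.
  by apply: functional_extensionality_dep => i; apply: functional_extensionality => m; apply: H.
by subst g; f_equal; apply: proof_irrelevance.
Qed.

Lemma hf0 (M N : gmod k) (f : ghom M N) i : hf f (0 : gcar M i) = 0.
Proof. by rewrite -[0 in LHS](scale0r 0) (lin_scale (hf_lin f (i := i))) scale0r. Qed.

Lemma gx0 (M : gmod k) i : gx M (0 : gcar M i) = 0.
Proof. by rewrite -[0 in LHS](scale0r 0) (lin_scale (@gx_lin _ M i)) scale0r. Qed.

Lemma gy0 (M : gmod k) i : gy M (0 : gcar M (i + 1)) = 0.
Proof. by rewrite -[0 in LHS](scale0r 0) (lin_scale (@gy_lin _ M i)) scale0r. Qed.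

Lemma hfZ (M N : gmod k) (f : ghom M N) i c (m : gcar M i) : hf f (c *: m) = c *: hf f m.
Proof. exact: (lin_scale (hf_lin f (i := i))). Qed.

Lemma gxZ (M : gmod k) i c (m : gcar M i) : gx M (c *: m) = c *: gx M m.
Proof. exact: (lin_scale (@gx_lin _ M i)). Qed.

Lemma gyZ (M : gmod k) i c (m : gcar M (i + 1)) : gy M (c *: m) = c *: gy M m.
Proof. exact: (lin_scale (@gy_lin _ M i)). Qed.

Lemma giso_sym (M N : gmod k) : giso M N -> giso N M.
Proof. by case=> f [g [h1 h2]]; exists g, f. Qed.

Lemma giso_trans (M N P : gmod k) : giso M N -> giso N P -> giso M P.
Proof.
case=> f [g [h1 h2]] [f' [g' [h1' h2']]].
exists (hcomp f' f), (hcomp g g'); split=> i m /=.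
  by rewrite [hf g' _](h1' i) [LHS](h1 i).
by rewrite [hf f _](h2 i) [LHS](h2' i).
Qed.

Lemma bij_giso (M N : gmod k) (f : ghom M N) :
  (forall i, injective (@hf _ _ _ f i)) ->
  (forall i (n : gcar N i), exists m, hf f m = n) -> giso M N.
Proof.
move=> finj fsurj.
(* Restated with the boolean [==] so that [xchoose] can select preimages. *)
have fs i (n : gcar N i) : exists m, hf f m == n.
  by have [m <-] := fsurj i n; exists m.
pose g i (n : gcar N i) : gcar M i := xchoose (fs i n).
have fg i (n : gcar N i) : hf f (g i n) = n := eqP (xchooseP (fs i n)).
have gl i : linear (g i).
  by move=> a u v; apply: finj; rewrite fg (hf_lin f) !fg.
have ghx i (n : gcar N i) : g _ (gx N n) = gx M (g _ n).
  by apply: finj; rewrite fg hf_x fg.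
have ghy i (n : gcar N (i + 1)) : g _ (gy N n) = gy M (g _ n).
  by apply: finj; rewrite fg hf_y fg.
exists f, (GHom gl ghx ghy); split=> i m /=; last exact: fg.
by apply: finj; rewrite fg.
Qed.

Definition hzero (M N : gmod k) (f : ghom M N) := forall i (m : gcar M i), hf f m = 0.

Definition gzero (M : gmod k) := forall i (m : gcar M i), m = 0.

Lemma not_hzero (M N : gmod k) (f : ghom M N) :
  ~ hzero f -> exists i (m : gcar M i), hf f m <> 0.
Proof.
move=> h; apply: NNPP => h'; apply: h => i m; apply: NNPP => hm.
by apply: h'; exists i, m.
Qed.

Lemma not_gzero (M : gmod k) : ~ gzero M -> exists i (m : gcar M i), m <> 0.
Proof.
move=> h; apply: NNPP => h'; apply: h => i m; apply: NNPP => hm.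
by apply: h'; exists i, m.
Qed.

Definition omega_fun (M : gmod k) i (m : gcar M i) : gcar M i :=
  i%:~R *: m - gy M (gx M m).

Lemma omega_lin (M : gmod k) i : linear (@omega_fun M i).
Proof.
move=> a u v; rewrite /omega_fun (@gx_lin _ M i) (@gy_lin _ M i).
by rewrite scalerBr scalerDr !scalerA [_ * a]mulrC opprD addrACA.
Qed.

Lemma gyx (M : gmod k) i (m : gcar M (i + 1)) : gx M (gy M m) = gy M (gx M m) - m.
Proof. by rewrite [X in X - m](canRL (subrK _) (g_rel m)) [RHS]addrC addKr. Qed.

(** Passing [x] changes the action of xy by one, and the degree term changes by the same amount. *)
Lemma omega_x (M : gmod k) i (m : gcar M i) : omega_fun (gx M m) = gx M (omega_fun m).
Proof.
rewrite /omega_fun (zmod_morphism_linear (@gx_lin _ M i)) gxZ gyx.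
by rewrite intrD scalerDl scale1r opprB addrA.
Qed.

Lemma omega_y (M : gmod k) i (m : gcar M (i + 1)) : omega_fun (gy M m) = gy M (omega_fun m).
Proof.
rewrite /omega_fun (zmod_morphism_linear (@gy_lin _ M i)) gyZ gyx.
rewrite (zmod_morphism_linear (@gy_lin _ M i)) intrD scalerDl scale1r.
by rewrite opprB addrA.
Qed.

Definition omega (M : gmod k) : ghom M M :=
  GHom (@omega_lin M) (@omega_x M) (@omega_y M).

Lemma omega_nat (M N : gmod k) (f : ghom M N) :
  hcomp f (omega M) = hcomp (omega N) f.
Proof.
apply: heq_eq => i m /=; rewrite /omega_fun (zmod_morphism_linear (hf_lin f (i := i))).
by rewrite hfZ hf_y hf_x.
Qed.

(** This says that [omega] is the scalar [l], called the weight of [M] below. In degree 0 it reads z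
    + l = 0, the relation defining M_l. *)
Definition scal (M : gmod k) (l : k) :=
  forall i (m : gcar M i), gy M (gx M m) = (i%:~R - l) *: m.

Lemma scal_omega (M : gmod k) l : scal M l <-> omega M = hscale l (hid M).
Proof.
split=> [h|h].
  by apply: heq_eq => i m /=; rewrite /omega_fun h scalerBl opprB addrC subrK.
move=> i m; have /= : hf (omega M) m = hf (hscale l (hid M)) m by rewrite h.
rewrite /omega_fun => /eqP; rewrite subr_eq => /eqP e.
by rewrite scalerBl e addrC addKr.
Qed.

Lemma scal_xy (M : gmod k) l : scal M l ->
  forall i (m : gcar M (i + 1)), gx M (gy M m) = (i%:~R - l) *: m.
Proof.
move=> h i m; rewrite gyx h intrD -[X in _ - X]scale1r -scalerBl.
by congr (_ *: _); rewrite addrAC addrK.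
Qed.

(** A map commutes with xy, so xy multiplies a nonzero image vector by both i - l and i - l'. *)
Lemma scal_eq (M N : gmod k) l l' (f : ghom M N) :
  scal M l -> scal N l' -> ~ hzero f -> l = l'.
Proof.
move=> hM hN /not_hzero [i [m hm]].
have: (i%:~R - l) *: hf f m = (i%:~R - l') *: hf f m.
  by rewrite -hfZ -hM hf_y hf_x hN.
move/eqP; rewrite -subr_eq0 -scalerBl scaler_eq0 => /orP[|/eqP //].
by rewrite opprB addrC addrA subrK subr_eq0 eq_sym => /eqP.
Qed.

Lemma scal_shift (M : gmod k) l n : scal M l -> scal (shift n M) (l + n%:~R).
Proof.
move=> h i m /=; rewrite /shy /shx castg_comp castg_refl h intrB.
by congr (_ *: _); rewrite opprD addrA addrAC.
Qed.

Lemma giso_scal (M N : gmod k) l : giso M N -> scal M l -> scal N l.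
Proof.
case=> f [g [h1 h2]] hM i n.
have e : n = hf f (hf g n) := esym (h2 i n).
by rewrite [in LHS]e -hf_x -hf_y hM hfZ -e.
Qed.

Lemma giso_gzero (M N : gmod k) : giso M N -> gzero M -> gzero N.
Proof.
case=> f [g [h1 h2]] hM i n.
have -> : n = hf f (hf g n) := esym (h2 i n).
by rewrite (hM _ (hf g n)) hf0.
Qed.

End Category.

(** * Modules with pieces of dimension at most one *)

Section Line.
Variable k : fieldType.

(** For a row of Boolean length this is its coordinate, or 0 outside the support, obtained without a
    case distinction on the type. *)
Definition rsum n (r : 'rV[k]_n) : k := \sum_j r 0 j.

Lemma rsum_lin n a (u v : 'rV[k]_n) : rsum (a *: u + v) = a * rsum u + rsum v.
Proof.
rewrite /rsum mulr_sumr -big_split.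
by apply: eq_bigr => j _; rewrite !mxE.
Qed.

Lemma rsumZ n a (r : 'rV[k]_n) : rsum (a *: r) = a * rsum r.
Proof. by rewrite /rsum mulr_sumr; apply: eq_bigr => j _; rewrite !mxE. Qed.

Lemma rsum_J1 (a b : bool) (r : 'rV[k]_a) : rsum (r *m J1 k a b) = b%:R * rsum r.
Proof.
rewrite /rsum; under eq_bigr => j _ do rewrite mxE.
under eq_bigr => j _ do under eq_bigr => l _ do rewrite mxE mulr1.
by rewrite sumr_const card_ord mulr_natl.
Qed.

Lemma row_out (a : bool) (r : 'rV[k]_a) : ~~ a -> r = 0.
Proof. by case: a r => // r _; apply/rowP => -[]. Qed.

Lemma row_bool (a : bool) (r : 'rV[k]_a) : r = rsum r *: const_mx 1.
Proof.
case: a r => r; last by apply/rowP => -[].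
by apply/rowP => j; rewrite !mxE mulr1 /rsum big_ord1 (ord1 j).
Qed.

Lemma rsum_const (a : bool) : rsum (const_mx 1 : 'rV[k]_a) = a%:R.
Proof. by rewrite /rsum; under eq_bigr => j _ do rewrite mxE; rewrite sumr_const card_ord. Qed.

Lemma const_J1 (a b : bool) :
  (const_mx 1 : 'rV[k]_a) *m J1 k a b = a%:R *: const_mx 1.
Proof.
case: b; last by apply/rowP => -[].
by rewrite [LHS]row_bool rsum_J1 rsum_const mul1r.
Qed.

Section LineMaps.
Variables (S : int -> bool) (cx cy : int -> k).
Hypothesis h : forall i, S (i + 1) ->
      cy (i + 1) * cx (i + 1) * (S (i + 1 + 1) : nat)%:R
      - cx i * cy i * (S i : nat)%:R = 1.

Lemma line_scal l :
  (forall i, S i -> cx i * cy i * (S (i + 1))%:R = i%:~R - l) -> scal (linemod h) l.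
Proof.
move=> H i m; rewrite /= /lnx /lny -!scalemxAl J1J1 !scalerA.
have [Si|Si] := orP (orbN (S i)); last by rewrite [m]row_out // !scaler0.
by rewrite -H // -[cx i * _]mulrC.
Qed.

Variable M : gmod k.
Variable w : forall i, gcar M i.
Hypothesis hx : forall i, S i -> gx M (w i) = (cx i * (S (i + 1))%:R) *: w (i + 1).
Hypothesis hy : forall i, S (i + 1) -> gy M (w (i + 1)) = (cy i * (S i)%:R) *: w i.

Definition line_fun i (r : 'rV[k]_(S i)) : gcar M i := rsum r *: w i.

Lemma line_fun_lin i : linear (@line_fun i).
Proof. by move=> a u v; rewrite /line_fun rsum_lin scalerDl scalerA. Qed.

Lemma line_fun_x i (m : gcar (linemod h) i) :
  line_fun (gx (linemod h) m) = gx M (line_fun m).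
Proof.
rewrite /line_fun gxZ /= /lnx rsumZ rsum_J1.
have [Si|Si] := orP (orbN (S i)); first by rewrite hx // scalerA mulrA mulrC.
by rewrite [m]row_out // /rsum big1 ?mulr0 ?scale0r // => j _; rewrite mxE.
Qed.

Lemma line_fun_y i (m : gcar (linemod h) (i + 1)) :
  line_fun (gy (linemod h) m) = gy M (line_fun m).
Proof.
rewrite /line_fun gyZ /= /lny rsumZ rsum_J1.
have [Si|Si] := orP (orbN (S (i + 1))); first by rewrite hy // scalerA mulrA mulrC.
by rewrite [m]row_out // /rsum big1 ?mulr0 ?scale0r // => j _; rewrite mxE.
Qed.

Definition line_hom : ghom (linemod h) M :=
  @GHom k (linemod h) M (fun i => @line_fun i) line_fun_lin line_fun_x line_fun_y.

End LineMaps.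

(** The support may start or stop only between i and i + 1 with i = l, where the coefficient i - l
    vanishes, so truncating the basis to [S] preserves the Weyl relation. *)
Definition adm (l : k) (S : int -> bool) : Prop :=
  forall i, S i != S (i + 1) -> i%:~R = l.

Lemma adm_rel l S (hS : adm l S) i : S (i + 1) ->
  ((i + 1)%:~R - l) * 1 * (S (i + 1 + 1) : nat)%:R - 1 * (i%:~R - l) * (S i : nat)%:R = 1.
Proof.
move=> Si1.
have -> : ((i + 1)%:~R - l) * 1 * (S (i + 1 + 1) : nat)%:R = (i + 1)%:~R - l.
  case E: (S (i + 1 + 1)); rewrite ?mulr1 // mulr0.
  by rewrite (hS (i + 1)) ?Si1 ?E // subrr.
have -> : 1 * (i%:~R - l) * (S i : nat)%:R = i%:~R - l.
  case E: (S i); rewrite ?mulr1 ?mul1r // mulr0.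
  by rewrite (hS i) ?Si1 ?E // subrr.
by rewrite intrD; ring.
Qed.

Definition Lmod l S (hS : adm l S) : gmod k := linemod (adm_rel hS).

Lemma Lmod_scal l S (hS : adm l S) : scal (Lmod hS) l.
Proof.
apply: line_scal => i Si; case E: (S (i + 1)); rewrite mul1r ?mulr1 ?mulr0 //.
by rewrite (hS i) ?Si ?E // subrr.
Qed.

(* [Lmod hS] has basis u_i (i in S) with u_i.x = u_{i+1}, u_{i+1}.y = (i - l) u_i.
   [std l S] holds exactly for S = Z (l not an integer), S = ]-oo, n] and
   S = ]n, +oo[ (l = n an integer), which give M_l, X<n> and Y<n>. *)
Record std (l : k) (S : int -> bool) : Prop := Std {
  std_adm :> adm l S;
  std_edge : forall i, S i -> S (i + 1) -> i%:~R <> l;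
  std_ex : exists i, S i;
  std_conv : forall i j m, i <= j -> j <= m -> S i -> S m -> S j }.

(** Convexity keeps the walk from [i0] inside the support, so [P] has to pass only along edges of
    [S]. *)
Lemma std_walk l S (hS : std l S) (P : int -> Prop) i0 :
  S i0 -> P i0 -> (forall i, S i -> S (i + 1) -> (P i <-> P (i + 1))) ->
  forall i, S i -> P i.
Proof.
move=> S0 P0 hP; apply: (int_walk (i0 := i0)) => // i hi IH Si.
  have Si' : S i by apply: (std_conv hS hi _ S0 Si); lia.
  by apply/(hP i) => //; apply: IH.
have Si' : S (i + 1) by apply: (std_conv hS _ _ Si S0); lia.
by apply/(hP i) => //; apply: IH.
Qed.

Definition bv l S (hS : adm l S) i : gcar (Lmod hS) i := const_mx 1.

Lemma bvP l S (hS : adm l S) i (m : gcar (Lmod hS) i) : exists a, m = a *: bv hS i.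
Proof. by exists (rsum m); apply: row_bool. Qed.

Lemma bv_out l S (hS : adm l S) i (m : gcar (Lmod hS) i) : ~~ S i -> m = 0.
Proof. exact: row_out. Qed.

Lemma bv_neq0 l S (hS : adm l S) i : S i -> bv hS i <> 0.
Proof.
move=> Si /(congr1 (@rsum _)); rewrite rsum_const.
have -> : (S i)%:R = 1 :> k by rewrite Si.
rewrite /rsum big1; last by move=> j _; rewrite mxE.
by move/eqP; rewrite oner_eq0.
Qed.

Lemma bv_x l S (hS : adm l S) i : S i -> gx (Lmod hS) (bv hS i) = bv hS (i + 1).
Proof.
move=> Si; rewrite /= /lnx const_J1.
have -> : (S i)%:R = 1 :> k by rewrite Si.
by rewrite !scale1r.
Qed.

Lemma bv_y l S (hS : adm l S) i : S (i + 1) ->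
  gy (Lmod hS) (bv hS (i + 1)) = (i%:~R - l) *: bv hS i.
Proof.
move=> Si; rewrite /= /lny const_J1.
have -> : (S (i + 1))%:R = 1 :> k by rewrite Si.
by rewrite scale1r.
Qed.

Section LmodHom.
Variables (l : k) (S : int -> bool) (hS : adm l S) (M : gmod k).

(** Inside [S] compatibility with [y] follows from that with [x] and the weight of [M]; only the
    ends of [S] need separate conditions. *)
Lemma Lmod_hom (w : forall i, gcar M i) :
  (forall i, S i -> S (i + 1) -> gx M (w i) = w (i + 1)) ->
  (forall i, S i -> ~~ S (i + 1) -> gx M (w i) = 0) ->
  (forall i, ~~ S i -> S (i + 1) -> gy M (w (i + 1)) = 0) ->
  scal M l ->
  exists f : ghom (Lmod hS) M, forall i, S i -> hf f (bv hS i) = w i.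
Proof.
move=> h1 h2 h3 hM.
have hx i : S i -> gx M (w i) = (1 * (S (i + 1))%:R) *: w (i + 1).
  move=> Si; rewrite mul1r; case E: (S (i + 1)).
    by rewrite scale1r; apply: h1.
  by rewrite scale0r; apply: h2; rewrite ?E.
have hy i : S (i + 1) -> gy M (w (i + 1)) = ((i%:~R - l) * (S i)%:R) *: w i.
  move=> Si; case E: (S i).
    by rewrite mulr1 -h1 // hM.
  by rewrite mulr0 scale0r; apply: h3; rewrite ?E.
exists (line_hom (adm_rel hS) hx hy) => i Si.
by rewrite /= /line_fun rsum_const Si scale1r.
Qed.
End LmodHom.

(** This is simplicity: along an edge of [S] one has i <> l, so [x] and [y] connect neighbouring
    basis vectors by nonzero scalars, and if one basis vector survives under [f], all do. *)
Lemma std_hom_inj l S (hS : std l S) (M : gmod k) (f : ghom (Lmod hS) M) :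
  ~ hzero f -> forall i (m : gcar (Lmod hS) i), hf f m = 0 -> m = 0.
Proof.
move=> /not_hzero [i0 [m0 hm0]].
have [a0 e0] := bvP m0.
have S0 : S i0.
  by apply/negPn/negP => n0; apply: hm0; rewrite (bv_out m0 n0) hf0.
have h0 : hf f (bv hS i0) <> 0 by move=> e; apply: hm0; rewrite e0 hfZ e scaler0.
have h i : S i -> hf f (bv hS i) <> 0.
  move: i; apply: (std_walk (P := fun i => hf f (bv hS i) <> 0) hS S0) => // i Si Si1.
  split=> hi e; apply: hi.
    have /= := congr1 (fun t => gy M t) e; rewrite -bv_x // hf_x => /eqP.
    rewrite gy0 -hf_x -hf_y Lmod_scal hfZ scaler_eq0 subr_eq0 => /orP[/eqP|/eqP //].
    by move/(std_edge hS Si Si1).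
  by rewrite -bv_x // hf_x e gx0.
move=> i m; have [Si|Si] := orP (orbN (S i)); last by rewrite (bv_out m).
have [a ->] := bvP m; rewrite hfZ => /eqP; rewrite scaler_eq0 => /orP[/eqP->|/eqP].
  by rewrite scale0r.
by move/(h _ Si).
Qed.

Lemma std_nz l S (hS : std l S) : ~ gzero (Lmod hS).
Proof. by move=> h; have [i Si] := std_ex hS; apply: (bv_neq0 (hS := hS) Si); apply: h. Qed.

(** Schur's lemma: the scalar is read off in one degree, carried up by [x], and carried down by
    cancelling i - l. *)
Lemma std_end l S (hS : std l S) (f : ghom (Lmod hS) (Lmod hS)) :
  exists c, f = hscale c (hid _).
Proof.
have [i0 S0] := std_ex hS.
have [c hc] := bvP (hf f (bv hS i0)).
have h i : S i -> hf f (bv hS i) = c *: bv hS i.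
  move: i; apply: (std_walk (P := fun i => hf f (bv hS i) = c *: bv hS i) hS S0) => //.
  move=> i Si Si1; split=> e.
    by rewrite -bv_x // hf_x e gxZ.
  have : (i%:~R - l) *: hf f (bv hS i) = (i%:~R - l) *: (c *: bv hS i).
    by rewrite -![(i%:~R - l) *: _]Lmod_scal -hf_x gxZ bv_x // e.
  apply: scalerI; rewrite subr_eq0; by apply/eqP; apply: (std_edge hS).
exists c; apply: heq_eq => i m /=.
have [Si|Si] := orP (orbN (S i)); last by rewrite (bv_out m) // scaler0 hf0.
by have [a ->] := bvP m; rewrite hfZ h // !scalerA mulrC.
Qed.

(** Injectivity puts [S] inside [S']. Once the supports agree, the map [e] matching the bases
    satisfies f e = c with c nonzero, and e / c is the right inverse. *)
Lemma std_hom_iso l S (hS : std l S) l' S' (hS' : std l' S') (f : ghom (Lmod hS) (Lmod hS')) :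
  ~ hzero f -> [/\ l = l', S =1 S' &
    exists g : ghom (Lmod hS') (Lmod hS), hcomp f g = hid _].
Proof.
move=> nf; have el := scal_eq (@Lmod_scal _ _ hS) (@Lmod_scal _ _ hS') nf.
subst l'; have fi := std_hom_inj nf.
have SS' i : S i -> S' i.
  move=> Si; apply/negPn/negP => ni; apply: (bv_neq0 (hS := hS) Si).
  by apply: fi; apply: bv_out.
(* An edge inside [S'] avoids i = l, the only place where [S] could stop. *)
have S'S i : S' i -> S i.
  have [i0 S0] := std_ex hS.
  move: i; apply: (std_walk (P := S) hS' (SS' _ S0)) => // i Si Si1.
  have := @std_adm _ _ hS i; have := std_edge hS' Si Si1.
  by case: (S i); case: (S (i + 1)) => // hi /(_ isT).
have eS : S =1 S' by move=> i; apply/idP/idP; [apply: SS' | apply: S'S].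
split=> //.
have [e he] : exists e : ghom (Lmod hS') (Lmod hS), forall i, S' i -> hf e (bv hS' i) = bv hS i.
  apply: Lmod_hom.
  - by move=> i Si _; apply: bv_x; rewrite eS.
  - by move=> i _ Si; apply: bv_out; rewrite eS.
  - by move=> i Si _; apply: bv_out; rewrite eS.
  - exact: Lmod_scal.
have [c hc] := std_end (hcomp f e).
have [i0 S0] := std_ex hS'.
have c0 : c != 0.
  apply/eqP => c0; have /= := congr1 (fun t => hf t (bv hS' i0)) hc.
  by rewrite he // c0 scale0r => /fi /bv_neq0; apply; rewrite eS.
exists (hscale c^-1 e); apply: heq_eq => i m.
have /= := congr1 (fun t => hf t m) hc.
by rewrite hfZ => ->; rewrite scalerA mulVf // scale1r.
Qed.

End Line.
Arguments Lmod_scal {k l S} hS.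

(** * Characteristic zero: standard modules and their maps *)

Section Char0.
Variable k : fieldType.
Hypothesis char0 : [pchar k] =i pred0.

Lemma intr_inj_char0 : injective (fun i : int => i%:~R : k).
Proof.
move=> i j /eqP; rewrite -subr_eq0 -intrB => h; apply/eqP; rewrite -subr_eq0.
have natr0 := (pcharf0P k).1 char0.
case: (i - j) h => n; first by rewrite -pmulrn natr0.
by rewrite NegzE mulrNz oppr_eq0 -pmulrn natr0.
Qed.

Lemma poly_eq0_char0 (p : {poly k}) : (forall l, p.[l] = 0) -> p = 0.
Proof.
move=> h; apply/eqP; apply: contraT => p0.
pose s := [seq (Posz n)%:~R : k | n <- iota 0 (size p)].
have us : uniq s.
  by rewrite map_inj_uniq ?iota_uniq // => m n /intr_inj_char0 [].
have rs : all (root p) s by apply/allP => x _; apply/eqP.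
by have := max_poly_roots p0 rs us; rewrite size_map size_iota ltnn.
Qed.

Definition isZ (l : k) : Prop := exists n : int, l = n%:~R.

Lemma std_all (l : k) : ~ isZ l -> std l (fun _ => true).
Proof.
move=> nl; split=> //; last by exists 0.
by move=> i _ _ e; apply: nl; exists i.
Qed.

Lemma std_le (n : int) : std (n%:~R : k) (fun i => i <= n).
Proof.
split; last by lia.
- by move=> i h; congr (_%:~R); lia.
- by move=> i h1 h2 /intr_inj_char0 h; lia.
- by exists n.
Qed.

Lemma std_gt (n : int) : std (n%:~R : k) (fun i => n < i).
Proof.
split; last by lia.
- by move=> i h; congr (_%:~R); lia.
- by move=> i h1 h2 /intr_inj_char0 h; lia.
- by exists (n + 1); lia.
Qed.

Lemma std_exists (l : k) : exists S, std l S.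
Proof.
case: (classic (isZ l)) => [[n ->]|h]; first by exists (fun i => i <= n); apply: std_le.
by exists (fun _ => true); apply: std_all.
Qed.

Lemma std_notZ (l : k) S : std l S -> ~ isZ l -> S =1 (fun _ => true).
Proof.
move=> hS nl; have [i0 S0] := std_ex hS.
have st i : S i = S (i + 1).
  by apply/eqP/negPn/negP => h; apply: nl; exists i; rewrite (std_adm hS h).
by apply: (int_walk (i0 := i0)) => // i _; rewrite -st.
Qed.

(** Membership can change only between n and n + 1. [std_edge] forbids both to lie in [S], and if
    neither did, [S] would be empty. *)
Lemma std_isZ (n : int) S : std (n%:~R : k) S ->
  S =1 (fun i => i <= n) \/ S =1 (fun i => n < i).
Proof.
move=> hS.
have st i : i != n -> S i = S (i + 1).
  by move=> hi; apply/eqP; apply: contraNT hi => /(std_adm hS) /intr_inj_char0 ->.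
case En: (S n).
  left; apply: (int_walk (i0 := n)) => [|i hi IH|i hi IH].
  - by rewrite En lexx.
  - have [ein|nin] := eqVneq i n.
      rewrite ein; case E: (S (n + 1)); last by lia.
      by have := std_edge hS En E.
    by rewrite -st // IH; lia.
  - by rewrite st ?IH; lia.
right; case En1: (S (n + 1)); last first.
  have [i0] := std_ex hS; suff -> : S i0 = false by [].
  move: i0; apply: (int_walk (i0 := n)) => // i hi IH; last by rewrite st ?IH; lia.
  by have [->//|nin] := eqVneq i n; rewrite -st.
apply: (int_walk (i0 := n)) => [|i hi IH|i hi IH].
- by rewrite En ltxx.
- have [->|nin] := eqVneq i n; first by rewrite En1; lia.
  by rewrite -st // IH; lia.
- by rewrite st ?IH; lia.
Qed.

(** Above [i0] the family follows [x]; below, it follows [y] divided by i - l, which [x] then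
    undoes. At i = l below [i0] the inverse defaults to 0, and the conclusion exempts that step. *)
Lemma scal_family (M : gmod k) l : scal M l -> forall i0 (v : gcar M i0),
  exists w : forall i, gcar M i, w i0 = v /\
    forall i, (i0 <= i \/ i%:~R <> l) -> gx M (w i) = w (i + 1).
Proof.
move=> hM i0 v.
have [w [w0 wu wd]] := @int_family (fun i => gcar M i) (fun i x => gx M x)
  (fun i x => (i%:~R - l)^-1 *: gy M x) i0 v.
exists w; split=> // i hi; case: (lerP i0 i) => h; first by rewrite wu.
case: hi => [|/eqP hi]; first by rewrite leNgt h.
by rewrite wd // gxZ (scal_xy hM) scalerA mulVf ?scale1r // subr_eq0.
Qed.

(** The end conditions are asked of every family through [v], because the family is produced only in
    the proof. In the applications any end of [S] is at [i0], where the family equals [v]. *)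
Lemma scal_gen (M : gmod k) l S (hS : std l S) i0 (v : gcar M i0) :
  scal M l -> S i0 -> v <> 0 ->
  (forall w : forall i, gcar M i, w i0 = v ->
     forall i, (S i -> ~~ S (i + 1) -> gx M (w i) = 0) /\
               (~~ S i -> S (i + 1) -> gy M (w (i + 1)) = 0)) ->
  exists f : ghom (Lmod hS) M, ~ hzero f.
Proof.
move=> hM S0 v0 hb; have [w [w0 hw]] := scal_family hM v.
have [f hf] : exists f : ghom (Lmod hS) M, forall i, S i -> hf f (bv hS i) = w i.
  apply: Lmod_hom => // [i Si Si1|i|i].
  - by apply: hw; right; apply: (std_edge hS).
  - by case: (hb w w0 i).
  - by case: (hb w w0 i).
by exists f => h; apply: v0; rewrite -w0 -hf // h.
Qed.

Lemma std_generates (M : gmod k) l : scal M l -> ~ gzero M ->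
  exists S (hS : std l S) (f : ghom (Lmod hS) M), ~ hzero f.
Proof.
move=> hM /not_gzero [j [v0 hv0]].
case: (classic (isZ l)) => [[n el]|nl]; last first.
  exists (fun _ => true), (std_all nl).
  by apply: (scal_gen (std_all nl) hM _ hv0).
subst l.
have gX (v : gcar M n) : v <> 0 -> gx M v = 0 ->
    exists S (hS : std (n%:~R : k) S) (f : ghom (Lmod hS) M), ~ hzero f.
  move=> nv hv; exists (fun i => i <= n), (std_le n).
  apply: (scal_gen (std_le n) hM _ nv) => [|w wn i]; first exact: lexx.
  split=> h1 h2; last by lia.
  have ei : i = n by lia.
  by rewrite ei wn.
have gY (v : gcar M (n + 1)) : v <> 0 -> gy M v = 0 ->
    exists S (hS : std (n%:~R : k) S) (f : ghom (Lmod hS) M), ~ hzero f.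
  move=> nv hv; exists (fun i => n < i), (std_gt n).
  apply: (scal_gen (std_gt n) hM _ nv) => [|w wn i]; first by lia.
  split=> h1 h2; first by lia.
  have ei : i = n by lia.
  by rewrite ei wn.
pose Pr i := exists v : gcar M i, v <> 0.
(* In weight n, xy kills degree n and yx kills degree n + 1. A nonzero v in degree n either dies
   under [x], or v.x is nonzero and dies under [y]; degree n + 1 is symmetric. *)
suff: Pr n \/ Pr (n + 1).
  case=> -[v nv].
    case: (classic (gx M v = 0)) => [|nx]; first exact: gX.
    by apply: (gY _ nx); rewrite hM subrr scale0r.
  case: (classic (gy M v = 0)) => [|ny]; first exact: gY.
  by apply: (gX _ ny); rewrite (scal_xy hM) subrr scale0r.
have ne i : i != n -> (i%:~R - n%:~R : k) != 0.
  by move=> hi; rewrite subr_eq0; apply: contraNneq hi => /intr_inj_char0 ->.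
(* Between degrees i and i + 1 both xy and yx act by the nonzero scalar i - n, so nonzero vectors
   can be moved towards degree n or n + 1. *)
have PrS i : i != n -> Pr i <-> Pr (i + 1).
  move=> hi; split=> -[v nv].
    exists (gx M v) => e; apply: nv; have := hM _ v.
    rewrite e gy0 => /esym/eqP; rewrite scaler_eq0 (negbTE (ne _ hi)).
    by move/eqP.
  exists (gy M v) => e; apply: nv; have := scal_xy hM v.
  rewrite e gx0 => /esym/eqP; rewrite scaler_eq0 (negbTE (ne _ hi)).
  by move/eqP.
suff: forall i, Pr i -> Pr n \/ Pr (n + 1) by apply; exists v0.
apply: (int_walk (i0 := n)) => [|i hi IH|i hi IH]; first by left.
- have [->|nin] := eqVneq i n; first by right.
  by move/(PrS i nin).
- have nin : i != n by lia.
  by move/(PrS i nin).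
Qed.

Lemma std_hom_giso (l : k) S (hS : std l S) (l' : k) S' (hS' : std l' S')
  (f : ghom (Lmod hS) (Lmod hS')) : ~ hzero f -> giso (Lmod hS) (Lmod hS').
Proof.
move=> nf; have [_ _ [g fg]] := std_hom_iso nf.
have fgE i m : hf f (hf g m) = m :> gcar (Lmod hS') i := congr1 (fun t => hf t m) fg.
exists f, g; split=> i m /=; last exact: fgE.
apply/eqP; rewrite -subr_eq0; apply/eqP/(std_hom_inj nf).
by rewrite (zmod_morphism_linear (hf_lin f (i := i))) fgE subrr.
Qed.

Lemma std_giso_supp (l : k) S (hS : std l S) (l' : k) S' (hS' : std l' S') :
  giso (Lmod hS) (Lmod hS') -> S =1 S'.
Proof.
case=> f [g [gf _]]; suff nf : ~ hzero f by have [] := std_hom_iso nf.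
by move=> h; apply: (std_nz (hS := hS)) => i m; rewrite -[m](gf i m) /= h hf0.
Qed.

Lemma std_supp_giso (l : k) S (hS : std l S) S' (hS' : std l S') :
  S =1 S' -> giso (Lmod hS) (Lmod hS').
Proof.
move=> eS.
have [f hf] : exists f : ghom (Lmod hS) (Lmod hS'), forall i, S i -> hf f (bv hS i) = bv hS' i.
  apply: Lmod_hom.
  - by move=> i Si _; apply: bv_x; rewrite -eS.
  - by move=> i _ Si; apply: bv_out; rewrite -eS.
  - by move=> i Si _; apply: bv_out; rewrite -eS.
  - exact: Lmod_scal.
apply: (@std_hom_giso _ _ _ _ _ _ f) => h; have [i Si] := std_ex hS.
by apply: (bv_neq0 (hS := hS') (i := i)); rewrite -?eS // -hf // h.
Qed.

(* [A[x^-1]]: its endomorphism ring is k[omega], and every module [Lmod] is a subquotient of it. *)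
Definition Qgy (i : int) (q : {poly k}) : {poly k} := (i%:~R%:P - 'X) * q.

Lemma Qgy_lin i : linear (Qgy i).
Proof. by move=> a u v; rewrite /Qgy mulrDr scalerAr. Qed.

Lemma Q_rel (i : int) (q : {poly k}) : Qgy (i + 1) q - Qgy i q = q.
Proof. by rewrite /Qgy intrD polyCD -mulrBl; ring. Qed.

Definition Qmod : gmod k :=
  @GMod k (fun _ => {poly k}) (fun _ q => q) Qgy (fun _ _ _ _ => erefl) Qgy_lin Q_rel.

(** Here [x] acts as the identity of k[t], so the image of 1 is the same polynomial in every
    degree. *)
Lemma Qmod_end (e : ghom Qmod Qmod) :
  exists p : {poly k}, forall i, hf e (1 : gcar Qmod i) = p.
Proof.
exists (hf e (1 : gcar Qmod 0)).
have st i : hf e (1 : gcar Qmod (i + 1)) = hf e (1 : gcar Qmod i).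
  exact: (hf_x e (1 : gcar Qmod i)).
by apply: (int_walk (i0 := 0)) => // i _ IH; rewrite -?IH // st.
Qed.

Lemma adm_all (l : k) : adm l (fun _ => true).
Proof. by []. Qed.

Definition Qeval_fun l i (q : gcar Qmod i) : gcar (Lmod (adm_all l)) i :=
  (q : {poly k}).[l] *: bv (adm_all l) i.

Lemma Qeval_lin l i : linear (@Qeval_fun l i).
Proof. by move=> a u v; rewrite /Qeval_fun hornerD hornerZ scalerDl scalerA. Qed.

Lemma Qeval_x l i (q : gcar Qmod i) :
  Qeval_fun l (gx Qmod q) = gx (Lmod (adm_all l)) (Qeval_fun l q).
Proof. by rewrite /Qeval_fun gxZ bv_x. Qed.

Lemma Qeval_y l i (q : gcar Qmod (i + 1)) :
  Qeval_fun l (gy Qmod q) = gy (Lmod (adm_all l)) (Qeval_fun l q).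
Proof.
rewrite /Qeval_fun gyZ bv_y // scalerA; congr (_ *: _).
by rewrite /= /Qgy hornerM hornerD hornerN hornerC hornerX mulrC.
Qed.

Definition Qeval l : ghom Qmod (Lmod (adm_all l)) :=
  GHom (@Qeval_lin l) (@Qeval_x l) (@Qeval_y l).

(** In the module with full support [x] maps basis vector to basis vector, so an upward closed [S]
    gives a submodule, while S = ]-oo, n] gives the quotient by the part above n. *)
Lemma std_sub_or_quo (l : k) S (hS : std l S) :
  (exists e : ghom (Lmod hS) (Lmod (adm_all l)),
     forall i, S i -> hf e (bv hS i) = bv (adm_all l) i) \/
  (exists e : ghom (Lmod (adm_all l)) (Lmod hS),
     forall i, hf e (bv (adm_all l) i) = bv hS i).
Proof.
have up : (forall i, S i -> S (i + 1)) ->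
    exists e : ghom (Lmod hS) (Lmod (adm_all l)),
     forall i, S i -> hf e (bv hS i) = bv (adm_all l) i.
  move=> hup; apply: Lmod_hom => [i _ _|i Si|i Si Si1|].
  - exact: bv_x.
  - by rewrite hup.
  - rewrite bv_y // (std_adm hS (i := i)) ?subrr ?scale0r //.
    by rewrite Si1 (negbTE Si).
  - exact: Lmod_scal.
case: (classic (isZ l)) => [[n el]|nl]; last first.
  by left; apply: up => i _; rewrite (std_notZ hS nl).
have hS' := hS; rewrite el in hS'.
case: (std_isZ hS') => eS; last by left; apply: up => i; rewrite !eS; lia.
right.
have [e he] : exists e : ghom (Lmod (adm_all l)) (Lmod hS),
     forall i, true -> hf e (bv (adm_all l) i) = bv hS i.
  apply: Lmod_hom => [i _ _|i _ //|i //|]; last exact: Lmod_scal.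
  have [Si|Si] := orP (orbN (S i)); first exact: bv_x.
  rewrite (bv_out (bv hS i)) // gx0 (bv_out (bv hS (i + 1))) //.
  by move: Si; rewrite !eS; lia.
by exists e => i; apply: he.
Qed.

(** Naturality along [Qeval l] and then along the sub or quotient map carries the polynomial from
    [Qmod] to each standard module. [theta] is a relation because the endomorphisms are known only
    to exist. *)
Lemma center_acts (theta : forall M : gmod k, ghom M M -> Prop) :
  (forall M, exists e, theta M e) ->
  (forall M N e e' (u : ghom M N), theta M e -> theta N e' -> hcomp u e = hcomp e' u) ->
  exists p : {poly k}, forall (l : k) S (hS : std l S) e,
    theta (Lmod hS) e -> e = hscale p.[l] (hid _).
Proof.
move=> tot nat; have [eQ tQ] := tot Qmod.
have [p hp] := Qmod_end eQ; exists p => l S hS e te.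
have [eT tT] := tot (Lmod (adm_all l)).
have hT i : hf eT (bv (adm_all l) i) = p.[l] *: bv (adm_all l) i.
  have := congr1 (fun t => hf t (1 : gcar Qmod i)) (nat _ _ _ _ (Qeval l) tQ tT).
  by rewrite /= hp /Qeval_fun hornerC scale1r => <-.
case: (std_sub_or_quo hS) => -[u hu]; apply: heq_eq => i m /=;
  (have [Si|Si] := orP (orbN (S i)); last by rewrite [LHS](bv_out _ Si) (bv_out m Si) scaler0);
  have [a ->] := bvP m; rewrite hfZ !scalerA mulrC -scalerA; congr (_ *: _).
  have := congr1 (fun t => hf t (bv hS i)) (nat _ _ _ _ u te tT).
  rewrite /= hu // hT.
  have nu : ~ hzero u.
    by move=> h; apply: (@bv_neq0 k l (fun _ => true) (adm_all l) i) => //; rewrite -hu // h.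
  (* In the submodule case the equation holds after applying [u], which is injective. *)
  move=> E; apply/eqP; rewrite -subr_eq0; apply/eqP/(std_hom_inj nu).
  by rewrite (zmod_morphism_linear (hf_lin u (i := i))) hfZ hu // E subrr.
have := congr1 (fun t => hf t (bv (adm_all l) i)) (nat _ _ _ _ u tT te).
by rewrite /= hT hfZ hu => ->.
Qed.

End Char0.

(** * The action of an autoequivalence on weights *)

Section Autoequivalence.
Variable k : fieldType.
Hypothesis char0 : [pchar k] =i pred0.
Variable F : gfunctor k.
Hypothesis Flin : klinear_functor F.
Hypothesis Feq : autoequivalence F.

Lemma Fh_comp (M N P : gmod k) (g : ghom N P) (f : ghom M N) :
  Fh F (hcomp g f) = hcomp (Fh F g) (Fh F f).
Proof. exact/heq_eq/F_comp. Qed.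

Lemma Fh_id (M : gmod k) : Fh F (hid M) = hid (Fo F M).
Proof. exact/heq_eq/F_id. Qed.

Lemma Fh_scale (M N : gmod k) c (f : ghom M N) : Fh F (hscale c f) = hscale c (Fh F f).
Proof. exact/heq_eq/Flin.2. Qed.

Lemma Fh_full (M N : gmod k) (g : ghom (Fo F M) (Fo F N)) : exists f, Fh F f = g.
Proof. by have [f /heq_eq] := Feq.1 M N g; exists f. Qed.

Lemma Fh_inj (M N : gmod k) (f g : ghom M N) : Fh F f = Fh F g -> f = g.
Proof. by move=> e; apply/heq_eq/Feq.2.1; rewrite e. Qed.

Lemma hzero_scale (M N : gmod k) (f : ghom M N) : hzero f <-> f = hscale 0 f.
Proof.
split=> [h|-> i m]; last by rewrite /= scale0r.
by apply: heq_eq => i m /=; rewrite scale0r h.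
Qed.

(** Vanishing is the equation f = 0 f, which linearity preserves and faithfulness reflects. *)
Lemma Fh_zero (M N : gmod k) (f : ghom M N) : hzero (Fh F f) <-> hzero f.
Proof.
rewrite !hzero_scale; split=> [e|{1}->]; last by rewrite Fh_scale.
by apply: Fh_inj; rewrite Fh_scale.
Qed.

Lemma gzero_id (M : gmod k) : gzero M <-> hzero (hid M).
Proof. by []. Qed.

Lemma Fo_gzero (M : gmod k) : gzero (Fo F M) <-> gzero M.
Proof. by rewrite !gzero_id -Fh_id Fh_zero. Qed.

Lemma hcomp_eq (M N P : gmod k) (g : ghom N P) (f : ghom M N) (e : ghom M P) :
  hcomp g f = e -> forall i (m : gcar M i), hf g (hf f m) = hf e m.
Proof. by move=> <-. Qed.

Lemma giso_eqs (M N : gmod k) : giso M N ->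
  exists (f : ghom M N) (g : ghom N M), hcomp g f = hid M /\ hcomp f g = hid N.
Proof. by case=> f [g [/heq_eq h1 /heq_eq h2]]; exists f, g. Qed.

Lemma Fo_giso (M N : gmod k) : giso M N -> giso (Fo F M) (Fo F N).
Proof.
move/giso_eqs => [f [g [h1 h2]]].
by exists (Fh F f), (Fh F g); rewrite -!Fh_comp h1 h2 !Fh_id.
Qed.

Lemma Fo_giso_reflect (M N : gmod k) : giso (Fo F M) (Fo F N) -> giso M N.
Proof.
move/giso_eqs => [f [g [h1 h2]]].
have [f' ef] := Fh_full f; have [g' eg] := Fh_full g; subst f g.
have h1' : hcomp g' f' = hid _ by apply: Fh_inj; rewrite Fh_comp h1 Fh_id.
have h2' : hcomp f' g' = hid _ by apply: Fh_inj; rewrite Fh_comp h2 Fh_id.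
by exists f', g'; rewrite h1' h2'.
Qed.

(* [center_acts] for F^-1(omega_{F M}). *)
Lemma Fo_central : exists p : {poly k}, forall (l : k) S (hS : std l S),
  scal (Fo F (Lmod hS)) p.[l].
Proof.
have [|M N e e' u he he'|p hp] := @center_acts k char0
  (fun M e => Fh F e = omega (Fo F M)).
- by move=> M; apply: Fh_full.
- by apply: Fh_inj; rewrite !Fh_comp he he' omega_nat.
exists p => l S hS; have [e he] := Fh_full (omega (Fo F (Lmod hS))).
by apply/scal_omega; rewrite -he (hp _ _ _ _ he) Fh_scale Fh_id.
Qed.

(* [center_acts] for g F(omega_M) g^-1 on N, where g : F M -> N is any isomorphism. *)
Lemma Fo_cocentral : exists q : {poly k}, forall (l : k) S (hS : std l S) M,
  giso (Fo F M) (Lmod hS) -> scal M q.[l].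
Proof.
have [|N N' e e' u [M [f [g [gf fg ->]]]] [M' [f' [g' [gf' fg' ->]]]]|q hq] := @center_acts k char0
  (fun N e => exists M (f : ghom (Fo F M) N) (g : ghom N (Fo F M)),
     [/\ hcomp g f = hid _, hcomp f g = hid _ & e = hcomp f (hcomp (Fh F (omega M)) g)]).
- move=> N; have [M /giso_eqs [f [g [gf fg]]]] := Feq.2.2 N.
  by exists (hcomp f (hcomp (Fh F (omega M)) g)), M, f, g.
(* The preimages [M] and [M'] are arbitrary; fullness lifts [u] to a map [a] between them, along
   which [omega] is natural. *)
- have [a ha] := Fh_full (hcomp g' (hcomp u f)).
  have := congr1 (Fh F) (omega_nat a); rewrite !Fh_comp ha => E.
  apply: heq_eq => i m.
  have /= := congr1 (fun t => hf f' (hf t (hf g m))) E.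
  by rewrite (hcomp_eq fg') (hcomp_eq fg).
exists q => l S hS M /giso_eqs [f [g [gf fg]]].
have e := hq l S hS _ (ex_intro _ M (ex_intro _ f (ex_intro _ g (And3 gf fg erefl)))).
apply/scal_omega/Fh_inj; rewrite Fh_scale Fh_id; apply: heq_eq => i m.
have := congr1 (fun t => hf g (hf t (hf f m))) e.
by rewrite /= hfZ !(hcomp_eq gf).
Qed.

(* A nonzero map u : Lmod hS' -> F (Lmod hS) is F h up to isomorphism; h is mono because
   u is injective, and split epi because its source M' receives a map s from a standard
   module and h s is a nonzero map between standard modules. *)
Lemma std_image_of_scal l S (hS : std l S) l' : scal (Fo F (Lmod hS)) l' ->
  exists S' (hS' : std l' S'), giso (Fo F (Lmod hS)) (Lmod hS').
Proof.
move=> sF; have [|S' [hS' [u nu]]] := std_generates char0 sF.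
  by move/Fo_gzero/(std_nz (hS := hS)).
exists S', hS'.
have [M' iM'] := Feq.2.2 (Lmod hS').
have [f [g [gf fg]]] := giso_eqs iM'.
have [h eh] := Fh_full (hcomp u f).
have hmono P (a b : ghom P M') : hcomp h a = hcomp h b -> a = b.
  move/(congr1 (Fh F)); rewrite !Fh_comp eh => E; apply/Fh_inj/heq_eq => i m.
  rewrite -[LHS](hcomp_eq gf) -[RHS](hcomp_eq gf); congr (hf g _).
  apply/eqP; rewrite -subr_eq0; apply/eqP/(std_hom_inj nu).
  rewrite (zmod_morphism_linear (hf_lin u (i := i))).
  by have /= -> := congr1 (fun t => hf t m) E; rewrite subrr.
(* [M'] inherits the weight through the mono [h], along which [omega] is natural. *)
have sM' : scal M' l.
  apply/scal_omega/hmono; rewrite omega_nat ((scal_omega _ _).1 (Lmod_scal hS)).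
  by apply: heq_eq => i m /=; rewrite hfZ.
have nzM' : ~ gzero M'.
  by move/Fo_gzero/(giso_gzero iM')/(std_nz (hS := hS')).
have [S0 [hS0 [s ns]]] := std_generates char0 sM' nzM'.
have nhs : ~ hzero (hcomp h s).
  move=> z; apply: ns; apply/hzero_scale/hmono; apply: heq_eq => i m /=.
  by rewrite scale0r hf0; apply: z.
have [_ _ [t ht]] := std_hom_iso nhs.
(* From h s t = 1 follows h (s t h) = h, and [h] cancels on the left. *)
have sth : hcomp (hcomp s t) h = hid _.
  by apply: hmono; apply: heq_eq => i m /=; rewrite [LHS](hcomp_eq ht).
have isoM : giso M' (Lmod hS).
  exists h, (hcomp s t); rewrite sth; split=> // i m.
  by rewrite /= [LHS](hcomp_eq ht).
exact: giso_trans (giso_sym (Fo_giso isoM)) iM'.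
Qed.

(** For the second half, a preimage [M] of the given module has weight q(l) and receives a nonzero
    map [s] from a standard module. Up to isomorphism F(s) is a nonzero map between standard
    modules, hence invertible. *)
Lemma Fo_std : exists p q : {poly k},
  (forall (l : k) S (hS : std l S),
     exists S' (hS' : std p.[l] S'), giso (Fo F (Lmod hS)) (Lmod hS')) /\
  (forall (l : k) S (hS : std l S),
     exists S' (hS' : std q.[l] S'), giso (Fo F (Lmod hS')) (Lmod hS)).
Proof.
have [p hp] := Fo_central; have [q hq] := Fo_cocentral.
have im l S (hS : std l S) := std_image_of_scal (hp l S hS).
exists p, q; split=> // l S hS.
have [M iM] := Feq.2.2 (Lmod hS).
have nzM : ~ gzero M.
  by move/Fo_gzero/(giso_gzero iM)/(std_nz (hS := hS)).
have [S0 [hS0 [s ns]]] := std_generates char0 (hq _ _ _ _ iM) nzM.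
exists S0, hS0; have [S1 [hS1 i1]] := im _ _ hS0.
have [f [g [gf fg]]] := giso_eqs iM; have [f1 [g1 [gf1 fg1]]] := giso_eqs i1.
apply: giso_trans i1 _.
apply: (@std_hom_giso _ _ _ _ _ _ _ (hcomp f (hcomp (Fh F s) g1))) => z.
apply: ns; apply/Fh_zero => i m.
have /= := z i (hf f1 m); rewrite (hcomp_eq gf1) => /(congr1 (fun x => hf g x)).
by rewrite (hcomp_eq gf) hf0.
Qed.

(** Degrees multiply under composition, so both are 1; the coefficient of X gives a c = 1. *)
Lemma comp_linear (p q : {poly k}) : p \Po q = 'X ->
  exists a b c d : k, [/\ p = a *: 'X + b%:P, q = c *: 'X + d%:P & a * c = 1].
Proof.
move=> e.
have lin (r : {poly k}) : (size r <= 2)%N -> r = r`_1 *: 'X + (r`_0)%:P.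
  move=> sr; apply/polyP => -[|[|i]]; rewrite !coefE ?mulr0 ?mulr1 ?add0r ?addr0 //.
  by rewrite nth_default // (leq_trans sr).
have := size_comp_poly p q; rewrite e size_polyX /= => /esym/eqP.
rewrite muln_eq1 => /andP[/eqP sp /eqP sq].
have ep : p = p`_1 *: 'X + (p`_0)%:P by apply: lin; case: (size p) sp => [|[|[]]].
have eq : q = q`_1 *: 'X + (q`_0)%:P by apply: lin; case: (size q) sq => [|[|[]]].
exists p`_1, p`_0, q`_1, q`_0; split=> //.
move: e; rewrite {1}ep {1}eq.
rewrite comp_polyD comp_polyZ comp_polyX comp_polyC.
move/(congr1 (fun r : {poly k} => r`_1)).
by rewrite !coefE /= mulr1 !addr0.
Qed.

Lemma std_image : exists a b : int, (a = 1 \/ a = -1) /\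
  forall (l : k) S (hS : std l S),
    exists S' (hS' : std (a%:~R * l + b%:~R) S'), giso (Fo F (Lmod hS)) (Lmod hS').
Proof.
have [p [q [hp hq]]] := Fo_std.
(* A standard module over l is the image of one over q(l), so it has both weights p(q(l)) and l;
   being nonzero, it has only one. *)
have pq l : p.[q.[l]] = l.
  have [S hS] := std_exists char0 l.
  have [S1 [hS1 i1]] := hq _ _ hS; have [S2 [hS2 i2]] := hp _ _ hS1.
  have s1 := giso_scal (giso_trans (giso_sym i2) i1) (Lmod_scal hS2).
  apply: (scal_eq (f := hid (Lmod hS)) s1 (Lmod_scal hS)).
  exact: (std_nz (hS := hS)).
have XY (n : int) : ~ (fun i => i <= n) =1 (fun i => n < i).
  by move/(_ n); rewrite lexx ltxx.
(* Over a non-integer all standard modules are isomorphic, whereas the two over n are not, and [F]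
   reflects isomorphisms. *)
have pZ n : isZ p.[(n : int)%:~R].
  apply: NNPP => nz.
  have [S1 [h1 i1]] := hp _ _ (std_le char0 n).
  have [S2 [h2 i2]] := hp _ _ (std_gt char0 n).
  have i12 : giso (Lmod h1) (Lmod h2).
    by apply: std_supp_giso => i; rewrite (std_notZ h1 nz) (std_notZ h2 nz).
  apply: (XY n).
  exact: (std_giso_supp (Fo_giso_reflect (giso_trans i1 (giso_trans i12 (giso_sym i2))))).
have qZ n : isZ q.[(n : int)%:~R].
  apply: NNPP => nz.
  have [S1 [h1 i1]] := hq _ _ (std_le char0 n).
  have [S2 [h2 i2]] := hq _ _ (std_gt char0 n).
  have i12 : giso (Lmod h1) (Lmod h2).
    by apply: std_supp_giso => i; rewrite (std_notZ h1 nz) (std_notZ h2 nz).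
  apply: (XY n).
  exact: (std_giso_supp (giso_trans (giso_sym i1) (giso_trans (Fo_giso i12) i2))).
have pqX : p \Po q = 'X.
  apply/eqP; rewrite -subr_eq0; apply/eqP/(poly_eq0_char0 char0) => l.
  by rewrite hornerD hornerN horner_comp pq hornerX subrr.
have [a [b [c [d [ep eq ac]]]]] := comp_linear pqX.
have intc (r : {poly k}) (a' b' : k) : r = a' *: 'X + b'%:P ->
    (forall n : int, isZ r.[n%:~R]) -> isZ a' /\ isZ b'.
  (* The coefficients are b' = r(0) and a' = r(1) - r(0). *)
  move=> -> hr; have [m0 e0] := hr 0; have [m1 e1] := hr 1.
  rewrite !hornerE /= in e0 e1.
  split; last by exists m0; rewrite -e0 ?mulr0 ?add0r.
  by exists (m1 - m0); rewrite intrB -e0 -e1 ?mulr0 ?add0r ?mulr1 addrK.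
have [[a' ea] [b' eb]] := intc p a b ep pZ.
have [[c' ec] _] := intc q c d eq qZ.
exists a', b'; split; last first.
  move=> l S hS; have := hp _ _ hS.
  by rewrite ep !hornerE ea eb.
have ac' : a' * c' = 1.
  by apply: (intr_inj_char0 char0); rewrite intrM -ea -ec ac.
have: a' \is a GRing.unit by apply/unitrP; exists c'; rewrite [c' * _]mulrC.
by case/orP => /eqP; [left | right].
Qed.

End Autoequivalence.

(** * Identification of X<n>, Y<n> and M_l with standard modules *)

Section Standard.
Variable k : fieldType.
Hypothesis char0 : [pchar k] =i pred0.

(** [f] is injective, and surjective because each piece of [M] is at most a line and vanishes off
    [S]. *)
Lemma line_giso (l : k) S (hS : std l S) (M : gmod k) (f : ghom (Lmod hS) M) :
  ~ hzero f ->
  (forall i (m m' : gcar M i), m <> 0 -> exists a, m' = a *: m) ->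
  (forall i, ~~ S i -> forall m : gcar M i, m = 0) -> giso M (Lmod hS).
Proof.
move=> nf h1 h2; apply: giso_sym.
have fi i m := @std_hom_inj _ _ _ hS _ _ nf i m.
apply: (bij_giso (f := f)) => i => [m m' e|n].
  apply/eqP; rewrite -subr_eq0; apply/eqP/fi.
  by rewrite (zmod_morphism_linear (hf_lin f (i := i))) e subrr.
have [Si|Si] := orP (orbN (S i)); last by exists 0; rewrite hf0 (h2 _ Si n).
have [|a ->] := h1 i (hf f (bv hS i)) n; last by exists (a *: bv hS i); rewrite hfZ.
by move/fi/(bv_neq0 (hS := hS) Si).
Qed.

Lemma row_line (b : bool) (m m' : 'rV[k]_b) : m <> 0 -> exists a, m' = a *: m.
Proof.
move=> m0; exists (rsum m' / rsum m).
have r0 : rsum m != 0.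
  by apply/eqP => e; apply: m0; rewrite [m]row_bool e scale0r.
by rewrite [LHS]row_bool {2}[m]row_bool scalerA divfK.
Qed.

Lemma Xsh_std (n : int) : giso (Xsh k n) (Lmod (std_le char0 n)).
Proof.
have sX : scal (Xsh k n) n%:~R.
  rewrite -[n%:~R]add0r; apply: scal_shift; apply: line_scal => i Si.
  case E: (i + 1 <= 0); first by rewrite !mulr1 subr0.
  by rewrite mulr0 subr0; have -> : i = 0 by lia.
have nX : ~ gzero (Xsh k n).
  move=> h; have /= := h n; rewrite subrr => /(_ (const_mx 1)) /rowP /(_ 0).
  by rewrite !mxE => /eqP; rewrite oner_eq0.
have [S [hS [f nf]]] := std_generates char0 sX nX.
have out i : ~~ (i <= n) -> forall m : gcar (Xsh k n) i, m = 0.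
  by move=> hi m; apply: row_out; lia.
(* The support ]n, +oo[ would embed a nonzero vector into degree n + 1, where X<n> vanishes. *)
case: (std_isZ char0 hS) => eS; last first.
  have Si : S (n + 1) by rewrite eS; lia.
  by case: (bv_neq0 (hS := hS) Si); apply: (std_hom_inj nf); apply: out; lia.
apply: (giso_trans (line_giso nf _ _)).
- by move=> i m m'; apply: row_line.
- by move=> i; rewrite eS; apply: out.
- exact: std_supp_giso.
Qed.

Lemma Ysh_std (n : int) : giso (Ysh k n) (Lmod (std_gt char0 n)).
Proof.
have sY : scal (Ysh k n) n%:~R.
  (* A/yA has weight -1, since xy acts as i + 1 in degree i; the shifts by 1 and n add 1 and n. *)
  have -> : (n%:~R : k) = - 1 + 1%:~R + n%:~R by rewrite addNr add0r.
  do 2 apply: scal_shift; apply: line_scal => i Si.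
  by have -> : 0 <= i + 1 by [lia]; rewrite mul1r mulr1 intrD opprK.
have nY : ~ gzero (Ysh k n).
  move=> h; have /= := h (n + 1).
  have -> : n + 1 - n - 1 = 0 by lia.
  move=> /(_ (const_mx 1)) /rowP /(_ 0).
  by rewrite !mxE => /eqP; rewrite oner_eq0.
have [S [hS [f nf]]] := std_generates char0 sY nY.
have out i : ~~ (n < i) -> forall m : gcar (Ysh k n) i, m = 0.
  by move=> hi m; apply: row_out; lia.
case: (std_isZ char0 hS) => eS.
  have Si : S n by rewrite eS; lia.
  by case: (bv_neq0 (hS := hS) Si); apply: (std_hom_inj nf); apply: out; lia.
apply: (giso_trans (line_giso nf _ _)).
- by move=> i m m'; apply: row_line.
- by move=> i; rewrite eS; apply: out.
- exact: std_supp_giso.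
Qed.

Lemma Mlam_std (l : k) (nl : ~ isZ l) : giso (Mlam l) (Lmod (std_all nl)).
Proof.
have sM : scal (Mlam l) l.
  by apply: line_scal => i _; rewrite mulr1 Mcxy.
have nM : ~ gzero (Mlam l).
  move=> h; have /= := h 0; move=> /(_ (const_mx 1)) /rowP /(_ 0).
  by rewrite !mxE => /eqP; rewrite oner_eq0.
have [S [hS [f nf]]] := std_generates char0 sM nM.
apply: (giso_trans (line_giso nf _ _)).
- by move=> i m m'; apply: (@row_line true).
- by move=> i; rewrite (std_notZ hS nl).
- by apply: std_supp_giso; apply: (std_notZ hS nl).
Qed.

End Standard.

(** * From standard modules back to X, Y and M_lambda *)

Unset Implicit Arguments. Set Strict Implicit. Set Printing Implicit Defensive.

Theorem theorem5p3 (k : closedFieldType) (char0 : [pchar k] =i pred0)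
  (F : gfunctor k) (Flin : klinear_functor F) (Feq : autoequivalence F) :
  let P (a b : int) : Prop :=
    (forall n : int,
       (giso (Fo F (Xsh k n)) (Xsh k (a * n + b)) /\
        giso (Fo F (Ysh k n)) (Ysh k (a * n + b)))
    \/ (giso (Fo F (Xsh k n)) (Ysh k (a * n + b)) /\
        giso (Fo F (Ysh k n)) (Xsh k (a * n + b))))
    /\ (forall lambda : k, (forall z : int, lambda != z%:~R) ->
          giso (Fo F (Mlam lambda)) (Mlam (a%:~R * lambda + b%:~R))) in
  exists a b : int, (a = 1 \/ a = -1) /\ P a b /\
    (forall a' b' : int, (a' = 1 \/ a' = -1) -> P a' b' -> a' = a /\ b' = b).
Proof.
move=> P; have [a [b [ha hF]]] := std_image char0 Flin Feq.
have hFM M l S (hS : std l S) : giso M (Lmod hS) ->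
    exists S' (hS' : std (a%:~R * l + b%:~R) S'), giso (Fo F M) (Lmod hS').
  move=> iM; have [S' [hS' i']] := hF l S hS; exists S', hS'.
  exact: (giso_trans (Fo_giso F iM) i').
have XorY n M S (hS : std ((n : int)%:~R : k) S) : giso M (Lmod hS) ->
    (S =1 (fun i => i <= n) /\ giso M (Xsh k n)) \/
    (S =1 (fun i => n < i) /\ giso M (Ysh k n)).
  move=> iM; case: (std_isZ char0 hS) => eS; [left|right]; split=> //.
    apply: giso_trans iM (giso_trans (std_supp_giso hS (std_le char0 n) eS) _).
    exact/giso_sym/Xsh_std.
  apply: giso_trans iM (giso_trans (std_supp_giso hS (std_gt char0 n) eS) _).
  exact/giso_sym/Ysh_std.
have nXY n : ~ giso (Xsh k n) (Ysh k n).
  move=> iXY.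
  have iL := giso_trans (giso_sym (Xsh_std char0 n)) (giso_trans iXY (Ysh_std char0 n)).
  by have := std_giso_supp iL n; rewrite lexx ltxx.
have aZ (n : int) : a%:~R * n%:~R + b%:~R = (a * n + b)%:~R :> k.
  by rewrite intrD intrM.
exists a, b; split=> //; split; [split=> [n|l nl]|].
- have [SX [hX iX]] := hFM _ _ _ _ (Xsh_std char0 n).
  have [SY [hY iY]] := hFM _ _ _ _ (Ysh_std char0 n).
  (* This excludes the two cases in which both images are of the same type. *)
  have nFXY : ~ giso (Fo F (Xsh k n)) (Fo F (Ysh k n)).
    by move/(Fo_giso_reflect Feq)/nXY.
  move: hX iX hY iY; rewrite aZ => hX iX hY iY.
  case: (XorY _ _ _ _ iX) => -[_ jX]; case: (XorY _ _ _ _ iY) => -[_ jY].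
  + by case: nFXY; apply: giso_trans jX (giso_sym jY).
  + by left.
  + by right.
  + by case: nFXY; apply: giso_trans jX (giso_sym jY).
- have nZ : ~ isZ l by case=> n e; move: (nl n); rewrite e eqxx.
  have nZ' : ~ isZ (a%:~R * l + b%:~R).
    (* As a a = 1, the map l -> a l + b is inverted by n -> a (n - b). *)
    case=> n e; apply: nZ; exists (a * (n - b)).
    rewrite intrM intrB -e addrK mulrA -intrM.
    by have -> : a * a = 1 by [case: ha => ->]; rewrite mul1r.
  have [S [hS iS]] := hFM _ _ _ _ (Mlam_std char0 nZ).
  apply: giso_trans iS (giso_trans _ (giso_sym (Mlam_std char0 nZ'))).
  by apply: std_supp_giso; apply: (std_notZ hS nZ').
move=> a' b' _ [hP _].
(* Whichever of X and Y occurs, F(X<n>) has both weights; n = 0 and n = 1 then determine the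
   pair. *)
have deg n : a' * n + b' = a * n + b.
  have [S [hS iS]] := hFM _ _ _ _ (Xsh_std char0 n).
  have s1 : scal (Fo F (Xsh k n)) (a * n + b)%:~R.
    by rewrite -aZ; apply: giso_scal (giso_sym iS) (Lmod_scal hS).
  have s2 : scal (Fo F (Xsh k n)) (a' * n + b')%:~R.
    case: (hP n) => -[i1 _]; apply: giso_scal (giso_sym i1) _.
      exact: giso_scal (giso_sym (Xsh_std char0 _)) (Lmod_scal _).
    exact: giso_scal (giso_sym (Ysh_std char0 _)) (Lmod_scal _).
  apply: (intr_inj_char0 char0); apply: (scal_eq (f := hid _) s2 s1) => z.
  exact: (std_nz (hS := hS)) (giso_gzero iS z).
by have := deg 0; have := deg 1; lia.
Qed.
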